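(* Let $R$ be a principal ideal domain, let $A$ be a reduced countably generated torsion $R$-module, and let $G$ be the group of $R$-module automorphisms of $A$. (1) Let $n$ be a positive integer and let $\mathbf{a}=(a_1,\dotsc,a_n)$ and $\mathbf{b}=(b_1,\dotsc,b_n)$ be $n$-tuples of elements of $A$. If $\mathbf{a}\to\mathbf{b}$ and $\mathbf{b}\to\mathbf{a}$, then $\mathbf{a}$ and $\mathbf{b}$ lie in the same $G$-orbit, i.e. there is $g\in G$ with $g(a_i)=b_i$ for all $i=1,\dotsc,n$. (2) Let $S$ and $T$ be finite submodules of $A$. If $S\to T$ and $T\to S$, then $S$ and $T$ lie in the same $G$-orbit, i.e. there is $g\in G$ with $g(S)=T$.
   Context: A module is reduced if it has no nonzero divisible submodule. Degeneration: for $n$-tuples $\mathbf{a}=(a_1,\dotsc,a_n)$ and $\mathbf{b}=(b_1,\dotsc,b_n)$ in $A$, $\mathbf{a}$ degenerates to $\mathbf{b}$, written $\mathbf{a}\to\mathbf{b}$, if there is an $R$-module endomorphism $\phi$ of $A$ with $\phi(a_i)=b_i$ for $i=1,\dotsc,n$. For submodules $S,T$ of $A$, $S$ degenerates to $T$, written $S\to T$, if there is an $R$-module endomorphism $\phi$ of $A$ with $\phi(S)=T$. The group $G$ acts on $A^n$ diagonally and on the set of submodules of $A$ in the natural way. In (2), ''finite'' means having finitely many elements. *)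

(* Defs.v *)
From mathcomp Require Import all_boot all_order all_algebra all_classical.

Set Implicit Arguments.
Unset Strict Implicit.
Unset Printing Implicit Defensive.

Import GRing.Theory.
Local Open Scope classical_set_scope.
Local Open Scope ring_scope.

(** MathComp's [submod_closed], for classical sets. *)
Definition submodule (R : pzRingType) (A : lmodType R) (S : set A) : Prop :=
  submod_closed [in S].

(** Ideals are the submodules of the regular module [R^o].  A field counts as
    a principal ideal domain. *)
Definition principal_ideal_domain (R : idomainType) : Prop :=
  forall I : set R^o, submodule I ->
    exists d : R, I = range (fun r : R => r * d).

Definition generates (R : pzRingType) (A : lmodType R) (X : set A) : Prop :=
  smallest (@submodule R A) X = [set: A].

(** [countable] includes the finite sets. *)
Definition countably_generated (R : pzRingType) (A : lmodType R) : Prop :=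
  exists X : set A, countable X /\ generates X.

Definition torsion_module (R : idomainType) (A : lmodType R) : Prop :=
  forall x : A, exists r : R, r != 0 /\ r *: x = 0.

Definition divisible_submodule (R : idomainType) (A : lmodType R)
    (D : set A) : Prop :=
  submodule D /\ forall r : R, r != 0 -> [set r *: x | x in D] = D.

Definition reduced_module (R : idomainType) (A : lmodType R) : Prop :=
  forall D : set A, divisible_submodule D -> D = [set 0].

Definition tuple_degenerates (R : pzRingType) (A : lmodType R) (n : nat)
    (a b : n.-tuple A) : Prop :=
  exists phi : {linear A -> A}, forall i : 'I_n, phi (tnth a i) = tnth b i.

Definition submodule_degenerates (R : pzRingType) (A : lmodType R)
    (S T : set A) : Prop :=
  exists phi : {linear A -> A}, phi @` S = T.

(** The underlying set of the group [G] of automorphisms of [A]; the inverse of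
    a bijective linear map is linear. *)
Definition module_aut (R : pzRingType) (A : lmodType R) :
    set {linear A -> A} :=
  [set g : {linear A -> A} | bijective g].
Arguments module_aut {R} A.

Definition tuple_same_orbit (R : pzRingType) (A : lmodType R) (n : nat)
    (a b : n.-tuple A) : Prop :=
  exists g : {linear A -> A},
    module_aut A g /\ forall i : 'I_n, g (tnth a i) = tnth b i.

Definition submodule_same_orbit (R : pzRingType) (A : lmodType R)
    (S T : set A) : Prop :=
  exists g : {linear A -> A}, module_aut A g /\ g @` S = T.

(* Main.v *)
From HB Require Import structures.
Require Import Defs.
From mathcomp Require Import fingroup perm.
From mathcomp Require Import all_boot all_order all_algebra all_classical.

Set Implicit Arguments.
Unset Strict Implicit.
Unset Printing Implicit Defensive.

Import GRing.Theory.
Local Open Scope classical_set_scope.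
Local Open Scope ring_scope.

(** An endomorphism does not decrease heights.  If [phi] carries a tuple to
    another and some endomorphism carries it back, then [phi] restricts to an
    isomorphism between the finitely generated submodules that they span, and
    this isomorphism preserves the heights at all primes.  For finite
    submodules the same holds after the way back has been composed with a
    power of a permutation ([finite_set_left_inverse]).  So it suffices to
    extend a height-preserving isomorphism between two finitely generated
    torsion submodules to an automorphism of [A].  This is the back-and-forth
    argument of Kaplansky and Mackey for Ulm's theorem ([pi_extend_aut]); the
    countable set of generators makes countably many extensions
    by one element suffice.

    Heights are measured by a transfinite descending chain of submodules for
    each prime [p], namely the [p ^ alpha B] with [B] the [p]-primary
    component.  The chain is defined inductively ([tower]) and shown to be
    linearly ordered ([tower_chain]); reducedness says that it decreases
    strictly down to zero ([tower_stable]).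

    A partial isomorphism [F] from [S] to [T] is extended to a [p]-primary
    element [c] with [p c] in [S] as follows.  As [S] is artinian, [c] may be
    replaced by an element of greatest height in the coset [c + S]
    ([exists_max_height]); let [U] be the member of the chain that marks its
    height.  An image [d] must satisfy [p d = F (p c)], lie in [U] and have no
    translate by [T] in [p U] ([pi_adjoin]).  If no [p (c + s)], with [s] in
    both [S] and [U], lies in [p p U], then any [d] in [U] with
    [p d = F (p c)] works.  Otherwise [c] can be adjusted so that [p c = p e]
    with [e] in [p U], and the task is to find [d] for the element [c - e],
    which is killed by [p].  This is where Ulm invariants are usually compared
    by counting dimensions; here it follows from the surjectivity of injective
    endomorphisms of artinian modules ([artinian_correspondence_surj],
    [proper_socle]). *)

(** * Submodules and the descending chain condition *)

Section Submodules.
Variables (R : pzRingType) (A : lmodType R).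
Implicit Types (S K : set A) (x y c : A) (r : R).

Lemma submoduleP S :
  submodule S <-> S 0 /\ forall r x y, S x -> S y -> S (r *: x + y).
Proof.
split=> [[S0 Sl]|[S0 Sl]].
  split=> [|r x y Sx Sy]; first by move: S0; rewrite inE.
  by have /(_ r x y (mem_set Sx) (mem_set Sy)) := Sl; rewrite inE.
split=> [|r x y]; rewrite !inE //; exact: Sl.
Qed.

Lemma sub0 S : submodule S -> S 0.
Proof. by case/submoduleP. Qed.

Lemma subZ S r x : submodule S -> S x -> S (r *: x).
Proof.
by case/submoduleP=> S0 Sl Sx; rewrite -[_ *: _]addr0; exact: Sl.
Qed.

Lemma subD S x y : submodule S -> S x -> S y -> S (x + y).
Proof. by case/submoduleP=> S0 Sl Sx Sy; rewrite -[x]scale1r; exact: Sl. Qed.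

Lemma subN S x : submodule S -> S x -> S (- x).
Proof. by move=> hS Sx; rewrite -scaleN1r; exact: subZ. Qed.

Lemma subB S x y : submodule S -> S x -> S y -> S (x - y).
Proof. by move=> hS Sx Sy; apply: subD => //; exact: subN. Qed.

Lemma subDl S x y : submodule S -> S x -> S (x + y) -> S y.
Proof. by move=> hS Sx /(subB hS)/(_ Sx); rewrite addrC addKr. Qed.

Lemma subDr S x y : submodule S -> S y -> S (x + y) -> S x.
Proof. by rewrite addrC; exact: subDl. Qed.

Lemma submodule0 : submodule [set (0 : A)].
Proof.
by apply/submoduleP; split=> // r x y -> ->; rewrite scaler0 addr0.
Qed.

Lemma submoduleI S K : submodule S -> submodule K -> submodule (S `&` K).
Proof.
move=> hS hK; apply/submoduleP; split=> [|r x y [Sx Kx] [Sy Ky]].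
  by split; exact: sub0.
by split; apply: subD => //; exact: subZ.
Qed.

(** The submodule generated by a submodule [S] and one element [c]. *)
Definition adjoin S c : set A :=
  [set z | exists s r, S s /\ z = s + r *: c].

Lemma adjoin_sub S c : S `<=` adjoin S c.
Proof. by move=> s Ss; exists s, 0; rewrite scale0r addr0. Qed.

Lemma adjoin_self S c : submodule S -> adjoin S c c.
Proof.
by move=> hS; exists 0, 1; rewrite scale1r add0r; split=> //; exact: sub0.
Qed.

Lemma submodule_adjoin S c : submodule S -> submodule (adjoin S c).
Proof.
move=> hS; apply/submoduleP; split; first by apply: adjoin_sub; exact: sub0.
move=> r _ _ [s [a [Ss ->]]] [t [b [St ->]]].
exists (r *: s + t), (r * a + b); split.
  by apply: subD => //; exact: subZ.
by rewrite scalerDr scalerA scalerDl addrACA.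
Qed.

Lemma adjoin_min S c K : submodule K -> S `<=` K -> K c -> adjoin S c `<=` K.
Proof.
by move=> hK SK Kc _ [s [r [/SK Ks ->]]]; apply: subD => //; exact: subZ.
Qed.

(** The descending chain condition on the submodules of [S], as a minimality
    principle. *)
Definition artinian S : Prop :=
  forall P : set (set A), P !=set0 ->
    (forall K, P K -> submodule K /\ K `<=` S) ->
    exists2 K, P K & forall L, P L -> L `<=` K -> K `<=` L.

Lemma artinian0 : artinian [set (0 : A)].
Proof.
move=> P [K PK] Psub; exists K => // L PL _ x Kx.
have [_ /(_ x Kx) ->] := Psub K PK; apply: sub0; exact: (Psub L PL).1.
Qed.

Lemma artinianS S K : K `<=` S -> artinian S -> artinian K.
Proof.
move=> KS aS P P0 Psub; apply: aS => // L /Psub[hL LK].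
by split=> //; exact: subset_trans KS.
Qed.

End Submodules.

Lemma artinian_image (R : pzRingType) (A B : lmodType R) (h : {linear A -> B})
  (S : set A) : submodule S -> artinian S -> artinian (h @` S).
Proof.
move=> hS aS P [K0 PK0] Psub.
pose Q : set (set A) := [set L | exists2 K, P K & L = S `&` h @^-1` K].
have [| |_ [K PK ->] Kmin] := aS Q.
- by exists (S `&` h @^-1` K0); exists K0.
- move=> _ [K PK ->]; have [hK _] := Psub K PK; split; last by move=> x [].
  apply: submoduleI => //; apply/submoduleP; split=> [|r x y] /=.
    by rewrite raddf0; exact: sub0.
  by move=> Kx Ky; rewrite linearP; apply: subD => //; exact: subZ.
exists K => // L PL LK y Ky; have [_ /(_ y Ky) [x Sx yE]] := Psub K PK.
have [] := Kmin (S `&` h @^-1` L) _ _ x.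
- by exists L.
- by move=> z [Sz Lz]; split=> //; exact: LK.
- by split=> //=; rewrite yE.
by move=> _ /=; rewrite yE.
Qed.

(** * Primes in a principal ideal domain *)

Section PID.
Variable R : idomainType.
Implicit Types (p q r a b c d : R).

(** The ideal generated by [a] and [b] is the whole ring. *)
Definition comaximal a b : Prop := exists u v, u * a + v * b = 1.

(** [p] generates a nonzero maximal ideal; in a principal ideal domain these
    are the prime elements. *)
Definition prime_elt p : Prop :=
  [/\ p != 0, p \isn't a GRing.unit
    & forall r, (exists w, r = w * p) \/ comaximal p r].

Lemma comaximal_sym a b : comaximal a b -> comaximal b a.
Proof. by case=> u [v e]; exists v, u; rewrite addrC. Qed.

Lemma comaximalMl a b c :
  comaximal a c -> comaximal b c -> comaximal (a * b) c.
Proof.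
move=> [u [v e]] [u' [v' e']]; exists (u * u'), (u * a * v' + v).
rewrite -e -[u * a in RHS]mulr1 -e' mulrDl mulrDr addrA.
by congr (_ + _ + _); rewrite -!mulrA //; congr (_ * _); rewrite mulrCA.
Qed.

Lemma comaximalXl a c k : comaximal a c -> comaximal (a ^+ k) c.
Proof.
move=> ac; elim: k => [|k IH]; first by exists 1, 0; rewrite mulr1 mul0r addr0.
by rewrite exprS; exact: comaximalMl.
Qed.

Lemma comaximalXX a c k m : comaximal a c -> comaximal (a ^+ k) (c ^+ m).
Proof.
by move/(comaximalXl k)/comaximal_sym/(comaximalXl m)/comaximal_sym.
Qed.

Lemma comaximal_unit a : comaximal a a -> a \is a GRing.unit.
Proof.
case=> u [v]; rewrite -mulrDl => e; apply/unitrPr.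
by exists (u + v); rewrite mulrC.
Qed.

(** Two primes that are not comaximal are associated. *)
Lemma prime_elt_assoc p q : prime_elt p -> prime_elt q ->
  comaximal p q \/ exists2 w, w \is a GRing.unit & q = w * p.
Proof.
move=> [p0 pU pM] [q0 qU qM]; case: (pM q) => [[w qE]|]; last by left.
right; exists w => //; case: (qM p) => [[z pE]|[u [v e]]].
  apply/unitrPr; exists z; apply: (mulIf q0).
  by rewrite -mulrA -pE -qE mul1r.
case/negP: pU; apply: comaximal_unit; exists (u * w), v.
by rewrite -mulrA -qE.
Qed.

Hypothesis R_pid : principal_ideal_domain R.

(** The ascending chain condition on principal ideals, as a maximality
    principle. *)
Lemma pid_noether (P : set R) : P !=set0 ->
  exists2 r, P r & forall q, P q -> (exists w, r = w * q) ->
                             exists w, q = w * r.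
Proof.
move=> [r0 Pr0]; apply: contrapT => nmax.
have /choice[f fP] : forall r, exists q, P r ->
    [/\ P q, exists w, r = w * q & ~ exists w, q = w * r].
  move=> r; case: (pselect (P r)) => Pr; last by exists 0.
  apply: contrapT => nq; apply: nmax; exists r => // q Pq rq.
  by apply: contrapT => nqr; apply: nq; exists q.
pose s n := iter n f r0.
have Ps n : P (s n) by elim: n => //= n IH; have [] := fP _ IH.
have sdvd m n : (m <= n)%N -> exists w, s m = w * s n.
  move/subnK <-; elim: (n - m)%N => [|k [w e]].
    by exists 1; rewrite mul1r.
  have [_ [w' e'] _] := fP _ (Ps (k + m)%N); exists (w * w').
  by rewrite e e' mulrA.
pose I : set R^o := [set x | exists n w, x = w * s n].
have /R_pid[d IE] : submodule I.
  apply/submoduleP; split; first by exists 0%N, 0; rewrite mul0r.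
  move=> r _ _ [m [w ->]] [n [z ->]].
  have [w' e'] := sdvd _ _ (leq_maxl m n).
  have [z' e''] := sdvd _ _ (leq_maxr m n).
  exists (maxn m n), (r * (w * w') + z * z').
  by rewrite e' e'' mulrDl -!mulrA.
have : I d by rewrite IE; exists 1 => //; rewrite mul1r.
case=> n [w dE].
have : I (s n.+1) by exists n.+1, 1; rewrite mul1r.
rewrite IE => -[z _ zE]; have [_ _] := fP _ (Ps n); apply.
by exists (z * w); rewrite -mulrA -dE zE.
Qed.

Lemma exists_prime_dvd r : r != 0 -> r \isn't a GRing.unit ->
  exists2 p, prime_elt p & exists w, r = w * p.
Proof.
move=> r0 rU.
pose P : set R := [set q | q \isn't a GRing.unit /\ exists w, r = w * q].
have [|p [pU [w rE]] pmax] := @pid_noether P.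
  by exists r; split=> //; exists 1; rewrite mul1r.
have p0 : p != 0 by apply: contra_neq r0 => p0; rewrite rE p0 mulr0.
exists p; last by exists w.
split=> // x.
pose I : set R^o := [set z | exists a b, z = a * p + b * x].
have /R_pid[d IE] : submodule I.
  apply/submoduleP; split; first by exists 0, 0; rewrite !mul0r addr0.
  move=> c _ _ [a [b ->]] [a' [b' ->]]; exists (c * a + a'), (c * b + b').
  by rewrite scalerDr !mulrDl addrACA -!mulrA.
have : I p by exists 1, 0; rewrite mul1r mul0r addr0.
rewrite IE => -[a _ pE].
have : I x by exists 0, 1; rewrite mul1r mul0r add0r.
rewrite IE => -[b _ xE].
have [dU|dU] := boolP (d \is a GRing.unit).
  right; have : I d by rewrite IE; exists 1 => //; rewrite mul1r.
  case=> u [v dE]; exists (d^-1 * u), (d^-1 * v).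
  by rewrite -!mulrA -mulrDr -dE mulVr.
left; have [] := pmax d.
- by split=> //; exists (w * a); rewrite -mulrA pE.
- by exists a.
by move=> z dE; exists (b * z); rewrite -mulrA -dE xE.
Qed.

Lemma pid_ind (P : R -> Prop) :
  (forall u, u \is a GRing.unit -> P u) ->
  (forall q r, prime_elt q -> P r -> P (q * r)) ->
  forall r, r != 0 -> P r.
Proof.
move=> Pu Pq r r0; apply: contrapT => nPr.
have [|s [s0 nPs] smax] := @pid_noether [set s | s != 0 /\ ~ P s].
  by exists r.
have sU : s \isn't a GRing.unit by apply/negP => /Pu.
have [q hq [w sE]] := exists_prime_dvd s0 sU.
have w0 : w != 0 by apply: contra_neq s0 => w0; rewrite sE w0 mul0r.
have [||z wE] := smax w.
- by split=> // Pw; apply: nPs; rewrite sE mulrC; exact: Pq.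
- by exists q; rewrite mulrC.
case: hq => q0 /negP qU _; apply: qU; apply/unitrPr; exists z.
by apply: (mulfI w0); rewrite mulrA -sE mulrC -wE mulr1.
Qed.

(** Splitting off the part of [n] supported at the prime [p]. *)
Lemma prime_part p n : prime_elt p -> n != 0 ->
  exists k m, n = p ^+ k * m /\ comaximal p m.
Proof.
move=> hp; move: n; apply: pid_ind => [u uU|q _ hq [k [m [-> cm]]]].
  exists 0%N, u; rewrite mul1r; split=> //.
  by exists 0, u^-1; rewrite mul0r add0r mulVr.
case: (prime_elt_assoc hp hq) => [cq|[w wU ->]].
  exists k, (q * m); split; first by rewrite mulrCA.
  by apply/comaximal_sym/comaximalMl; exact: comaximal_sym.
exists k.+1, (w * m); split.
  by rewrite exprS -!mulrA mulrCA; congr (_ * _); rewrite mulrCA.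
apply/comaximal_sym/comaximalMl; last exact: comaximal_sym.
by exists w^-1, 0; rewrite mul0r addr0 mulVr.
Qed.

End PID.

(** * Finitely generated torsion modules are artinian *)

Section ArtinianAdjoin.
Variables (R : idomainType) (A : lmodType R).
Implicit Types (S K U V : set A) (x y c : A) (p r : R).

(** Adjoining [c] adds at most one composition factor, isomorphic to
    [R / (p)]. *)
Lemma artinian_adjoin_prime S c p : submodule S -> artinian S ->
  prime_elt p -> S (p *: c) -> artinian (adjoin S c).
Proof.
move=> hS aS [_ _ pM] Spc P [K0 PK0] Psub.
pose Q : set (set A) := [set L | exists2 K, P K & L = S `&` K].
have [| |_ [K PK ->] Kmin] := aS Q.
- by exists (S `&` K0); exists K0.
- move=> _ [K PK ->]; have [hK _] := Psub K PK; split; last by move=> x [].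
  exact: submoduleI.
have {}Kmin L : P L -> L `<=` K -> S `&` K `<=` L.
  move=> PL LK x SKx; have [] := Kmin (S `&` L) _ _ x => //; first by exists L.
  by move=> z [Sz Lz]; split=> //; exact: LK.
(* If some member below [K] lies in [S], it is minimal; otherwise [K] is. *)
case: (pselect (exists K', [/\ P K', K' `<=` K & K' `<=` S])).
  move=> [K' [PK' K'K K'S]]; exists K' => // L PL LK' x K'x.
  apply: (Kmin L) => //; first exact: subset_trans K'K.
  by split; [exact: K'S|exact: K'K].
move=> nK'; exists K => // L PL LK x Kx.
have [hK Ksub] := Psub K PK; have [hL Lsub] := Psub L PL.
have [y Ly nSy] : exists2 y, L y & ~ S y.
  apply: contrapT => ny; apply: nK'; exists L; split=> // y Ly.
  by apply: contrapT => nSy; apply: ny; exists y.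
have [s [r [Ss yE]]] := Lsub y Ly.
have [t [a [St xE]]] := Ksub x Kx.
case: (pM r) => [[w rE]|[u [v e]]].
  case: nSy; rewrite yE rE -scalerA.
  by apply: subD => //; exact: subZ.
(* Modulo [S], the element [c] is the multiple [v *: y] of [y]. *)
have Svyc : S (v *: y - c).
  rewrite yE scalerDr scalerA -{2}[c]scale1r -e scalerDl opprD.
  rewrite addrACA subrr addr0 -scalerA.
  by apply: subB => //; exact: subZ.
have : S (x - (a * v) *: y).
  rewrite xE -scalerA -addrA -scalerBr; apply: subD => //; apply: subZ => //.
  by rewrite -opprB; exact: subN.
move=> Sx; have : L (x - (a * v) *: y).
  apply: (Kmin L) => //; split=> //.
  by apply: subB => //; apply: subZ => //; exact: LK.
by move/(subD hL)/(_ (subZ (a * v) hL Ly)); rewrite subrK.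
Qed.

Hypothesis R_pid : principal_ideal_domain R.

Lemma artinian_adjoin S c r : submodule S -> artinian S ->
  r != 0 -> r *: c = 0 -> artinian (adjoin S c).
Proof.
move=> hS aS r0; move: r r0 c S hS aS.
apply: (pid_ind R_pid) => [u uU|q r hq IH] c S hS aS.
  move=> /(congr1 ( *:%R u^-1)); rewrite scalerA mulVr // scale1r scaler0 => ->.
  apply: artinianS aS; apply: adjoin_min => //; exact: sub0.
rewrite mulrC -scalerA => rqc; have aS' := IH _ _ hS aS rqc.
have hS' := submodule_adjoin (q *: c) hS.
have := artinian_adjoin_prime hS' aS' hq (adjoin_self _ hS).
apply: artinianS; apply: adjoin_min; first exact: submodule_adjoin.
  by apply: subset_trans (@adjoin_sub _ _ _ _); exact: adjoin_sub.
exact: adjoin_self.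
Qed.

(** The submodule generated by a finite list. *)
Definition span (s : seq A) : set A :=
  foldr (fun c S => adjoin S c) [set 0] s.

Lemma submodule_span s : submodule (span s).
Proof.
by elim: s => [|c s IH]; [exact: submodule0|exact: submodule_adjoin].
Qed.

Lemma span_mem s x : x \in s -> span s x.
Proof.
elim: s => // c s IH; rewrite inE => /orP[/eqP->|/IH].
  by apply: adjoin_self; exact: submodule_span.
exact: adjoin_sub.
Qed.

Lemma span_min s K : submodule K -> (forall x, x \in s -> K x) -> span s `<=` K.
Proof.
move=> hK; elim: s => [|c s IH] sK; first by move=> x ->; exact: sub0.
apply: adjoin_min => //; last by apply: sK; rewrite mem_head.
by apply: IH => x xs; apply: sK; rewrite inE xs orbT.
Qed.

Lemma artinian_span s : torsion_module A -> artinian (span s).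
Proof.
move=> tA; elim: s => [|c s IH]; first exact: artinian0.
have [r [r0 rc]] := tA c; apply: artinian_adjoin r0 rc => //.
exact: submodule_span.
Qed.

End ArtinianAdjoin.

(** * Generalized heights *)

Section Tower.
Variables (R : idomainType) (A : lmodType R).
Implicit Types (S K U V : set A) (x y c : A) (p q r : R).

(** The [p]-primary component. *)
Definition primary p : set A := [set x | exists k, p ^+ k *: x = 0].

(** The submodule [p U]. *)
Definition scale_set p U : set A := [set p *: x | x in U].

(** The transfinite chain of the submodules [p ^ alpha B], where [B] is the
    [p]-primary component: the least family that contains [B] and is closed
    under multiplication by [p] and under intersections.  The members that
    contain [x] play the part of the [p]-height of [x], and no ordinals are
    needed. *)
Inductive tower p : set A -> Prop :=
| tower_primary : tower p (primary p)
| tower_scale U : tower p U -> tower p (scale_set p U)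
| tower_cap (C : set (set A)) : (forall U, C U -> tower p U) ->
    tower p (primary p `&` [set x | forall U, C U -> U x]).

Lemma submodule_primary p : submodule (primary p).
Proof.
apply/submoduleP; split; first by exists 0%N; rewrite scaler0.
move=> r x y [k kx] [m my]; exists (k + m)%N.
rewrite scalerDr exprD -[_ *: y]scalerA my scaler0 addr0.
by rewrite scalerA -mulrA mulrC -scalerA kx scaler0.
Qed.

Lemma submodule_scale p U : submodule U -> submodule (scale_set p U).
Proof.
move=> hU; apply/submoduleP; split.
  by exists 0; [exact: sub0|rewrite scaler0].
move=> r _ _ [x Ux <-] [y Uy <-]; exists (r *: x + y).
  by apply: subD => //; exact: subZ.
by rewrite scalerDr !scalerA mulrC.
Qed.

Lemma scale_setS p U V : U `<=` V -> scale_set p U `<=` scale_set p V.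
Proof. by move=> UV _ [x /UV Vx <-]; exists x. Qed.

Lemma scale_sub p U : submodule U -> scale_set p U `<=` U.
Proof. by move=> hU _ [x Ux <-]; exact: subZ. Qed.

Lemma tower_submodule p U : tower p U -> submodule U.
Proof.
elim=> [|V _ hV|C _ hC]; first exact: submodule_primary.
  exact: submodule_scale.
apply: submoduleI; first exact: submodule_primary.
apply/submoduleP; split=> [V CV|r x y hx hy V CV].
  by apply: sub0; exact: hC.
have hV := hC V CV; apply: subD => //; first by apply: subZ => //; exact: hx.
exact: hy.
Qed.

Lemma tower_sub_primary p U : tower p U -> U `<=` primary p.
Proof.
elim=> [//|V tV VB|C _ _ x []//]; apply: subset_trans VB.
by apply: scale_sub; exact: tower_submodule tV.
Qed.

(** Members of the tower are fully invariant: heights do not decrease under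
    endomorphisms. *)
Lemma tower_endo p U (h : {linear A -> A}) x : tower p U -> U x -> U (h x).
Proof.
move=> tU; elim: tU x => [|V _ IH|C _ IH] x.
- by case=> k kx; exists k; rewrite -linearZ kx raddf0.
- by case=> y Vy <-; exists (h y); [exact: IH|rewrite linearZ].
case=> -[k kx] hx; split; first by exists k; rewrite -linearZ kx raddf0.
by move=> V CV; apply: IH => //; exact: hx.
Qed.

(** A member of the tower is a bottleneck if every member strictly above it
    stays above it when multiplied by [p]; every member is one. *)
Definition bottleneck p U : Prop := forall V, tower p V -> U `<=` V ->
  V `<=` U \/ U `<=` scale_set p V.

Lemma bottleneck_chain p U V : tower p U -> bottleneck p U -> tower p V ->
  V `<=` scale_set p U \/ U `<=` V.
Proof.
move=> tU eU; elim=> [|W tW IH|C tC IH].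
- by right; exact: tower_sub_primary.
- have hW := tower_submodule tW.
  case: IH => [WpU|UW]; last first.
    by case: (eU W tW UW) => [WU|]; [left; exact: scale_setS|right].
  by left; apply: subset_trans WpU; exact: scale_sub.
- have [allC|] := pselect (forall W, C W -> U `<=` W).
    right=> x Ux; split; first exact: tower_sub_primary Ux.
    by move=> W CW; exact: allC.
  move/existsNP=> [W /not_implyP[CW nUW]]; left.
  by case: (IH W CW) => // WpU x [_ /(_ W CW)]; exact: WpU.
Qed.

Lemma tower_bottleneck p U : tower p U -> bottleneck p U.
Proof.
elim=> [|W tW IH|C tC IH] V tV UV.
- by left; exact: tower_sub_primary.
- have hW := tower_submodule tW.
  case: (bottleneck_chain tW IH tV) => [|WV]; first by left.
  right; case: (IH V tV WV) => [VW|WpV]; first exact: scale_setS.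
  by apply: subset_trans WpV; exact: scale_sub.
- have [allC|] := pselect (forall W, C W -> V `<=` W).
    left=> x Vx; split; first exact: tower_sub_primary Vx.
    by move=> W CW; exact: allC.
  move/existsNP=> [W /not_implyP[CW nVW]]; right.
  have tW := tC W CW; have hW := tower_submodule tW.
  case: (bottleneck_chain tW (IH W CW) tV) => [VpW|WV].
    by case: nVW; apply: subset_trans VpW _; exact: scale_sub.
  case: (IH W CW V tV WV) => // WpV x [_ /(_ W CW)]; exact: WpV.
Qed.

(** The tower is a chain, and [scale_set p U] is the next member below [U]. *)
Lemma tower_chain p U V : tower p U -> tower p V ->
  V `<=` scale_set p U \/ U `<=` V.
Proof.
by move=> tU tV; exact: bottleneck_chain (tower_bottleneck tU) tV.
Qed.

(** Associated primes have the same tower. *)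
Lemma tower_assoc p w U : w \is a GRing.unit -> tower (w * p) U -> tower p U.
Proof.
move=> wU; have primE : primary (w * p) = primary p.
  apply/seteqP; split=> x [k kx]; exists k; last first.
    by rewrite exprMn -scalerA kx scaler0.
  have wkU : w ^+ k \is a GRing.unit by rewrite unitrX.
  by rewrite -[p ^+ k](mulKr wkU) -exprMn -scalerA kx scaler0.
elim=> [|V tV IH|C _ IH]; rewrite ?primE; first exact: tower_primary.
  have -> : scale_set (w * p) V = scale_set p V; last exact: tower_scale.
  have hV := tower_submodule IH.
  apply/seteqP; split=> _ [x Vx <-].
    by exists (w *: x); [exact: subZ|rewrite scalerA mulrC].
  by exists (w^-1 *: x); [exact: subZ|rewrite scalerA mulrAC mulrV // mul1r].
exact: tower_cap.
Qed.

(** The least member of the tower containing [x], for [x] primary. *)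
Definition hull p x : set A :=
  primary p `&` [set y | forall U, (tower p U /\ U x) -> U y].

Lemma tower_hull p x : tower p (hull p x).
Proof. by apply: (@tower_cap p [set U | tower p U /\ U x]) => U []. Qed.

Lemma hull_self p x : primary p x -> hull p x x.
Proof. by move=> px; split=> // U []. Qed.

Lemma hull_min p x U : tower p U -> U x -> hull p x `<=` U.
Proof. by move=> tU Ux y [_]; apply. Qed.

Hypothesis R_pid : principal_ideal_domain R.
Hypothesis A_reduced : reduced_module A.

(** The tower goes strictly down until it reaches zero: a member with
    [p U = U] is divisible, since the other primes act invertibly on it. *)
Lemma tower_stable p U : prime_elt p -> tower p U -> U `<=` scale_set p U ->
  U = [set 0].
Proof.
move=> hp tU UpU; have hU := tower_submodule tU.
apply: A_reduced; split=> //.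
apply: (pid_ind R_pid) => [u uU|q r hq IH].
  apply/seteqP; split=> [_ [x Ux <-]|x Ux]; first exact: subZ.
  by exists (u^-1 *: x); [exact: subZ|rewrite scalerA mulrV // scale1r].
apply/seteqP; split=> [_ [x Ux <-]|x Ux]; first exact: subZ.
suff [y Uy <-] : scale_set q U x.
  by move: Uy; rewrite -{1}IH => -[z Uz <-]; exists z; rewrite // scalerA.
case: (prime_elt_assoc hp hq) => [cpq|[w wU ->]].
  have [k kx] := tower_sub_primary tU Ux.
  have [u [v e]] := comaximalXl k cpq; exists (v *: x); first exact: subZ.
  by rewrite scalerA mulrC -[RHS]scale1r -e scalerDl -scalerA kx scaler0 add0r.
have [y Uy <-] := UpU x Ux; exists (w^-1 *: y); first exact: subZ.
by rewrite scalerA mulrAC mulrV // mul1r.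
Qed.

(** In particular [0] is its last member. *)
Lemma tower0 p : prime_elt p -> tower p [set 0].
Proof.
move=> hp; rewrite -(tower_stable hp (tower_hull p 0)); first exact: tower_hull.
apply: hull_min; first by apply: tower_scale; exact: tower_hull.
by apply: sub0; apply: submodule_scale; exact: tower_submodule (tower_hull p 0).
Qed.

(** A nonzero primary element does not lie one step below its hull. *)
Lemma mem_scale_hull p x : prime_elt p -> primary p x ->
  scale_set p (hull p x) x -> x = 0.
Proof.
move=> hp px sx; have : hull p x x by exact: hull_self.
rewrite (tower_stable hp (tower_hull p x)) //.
by apply: hull_min => //; by apply: tower_scale; exact: tower_hull.
Qed.

(** A coset of an artinian submodule has an element of greatest height: the
    traces [S `&` U] of the members [U] that meet the coset have a minimal
    element. *)
Lemma exists_max_height p S c : submodule S -> artinian S -> primary p c ->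
  exists s, [/\ S s, primary p (c + s)
    & forall t U, S t -> tower p U -> U (c + t) -> U (c + s)].
Proof.
move=> hS aS pc.
pose Q : set (set A) :=
  [set L | exists U, [/\ tower p U, exists2 s, S s & U (c + s) & L = S `&` U]].
have [| |_ [U [tU [s Ss Ucs] ->]] Umin] := aS Q.
- exists (S `&` primary p), (primary p); split=> //; first exact: tower_primary.
  by exists 0; rewrite ?addr0 //; exact: sub0.
- move=> _ [U [tU _ ->]]; split; last by move=> x [].
  by apply: submoduleI => //; exact: tower_submodule tU.
exists s; split=> //; first exact: tower_sub_primary Ucs.
move=> t V St tV Vct.
have hU := tower_submodule tU; have hV := tower_submodule tV.
have [VU|UV] : V `<=` U \/ U `<=` V.
- case: (tower_chain tU tV) => [VpU|]; [left|by right].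
  by move=> x /VpU; exact: scale_sub.
- have Sst : (S `&` U) (s - t).
    split; first exact: subB.
    have <- : c + s - (c + t) = s - t by rewrite opprD addrACA subrr add0r.
    by apply: subB => //; exact: VU.
  have [_ Vst] : (S `&` V) (s - t).
    apply: Umin Sst; first by exists V; split=> //; exists t.
    by move=> x [Sx Vx]; split=> //; exact: VU.
  by have := subD hV Vst Vct; rewrite addrCA subrK.
- exact: UV.
Qed.

End Tower.

(** * Surjectivity of correspondences on artinian modules *)

(** An injective endomorphism of an artinian module is surjective.  The module
    here is [M / N], and the endomorphism is given by its graph [rho], lifted
    to [M]; whether [rho] is single-valued modulo [N] plays no part. *)
Lemma artinian_correspondence_surj (R : pzRingType) (A : lmodType R)
    (M N : set A) (rho : set (A * A)%type) :
  submodule M -> artinian M -> submodule rho ->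
  (forall x, M x -> exists y, rho (x, y)) ->
  (forall x y, rho (x, y) -> M y) ->
  (forall y, N y -> rho (0, y)) ->
  (forall x x' y, rho (x, y) -> rho (x', y) -> N (x - x')) ->
  forall y, M y -> exists2 x, M x & rho (x, y).
Proof.
move=> hM aM hrho tot cod ker inj.
pose step (K : set A) : set A := [set y | exists2 x, K x & rho (x, y)].
pose K n := iter n step M.
have hK n : submodule (K n).
  elim: n => //= n IH; apply/submoduleP; split.
    by exists 0; [exact: sub0|exact: (sub0 hrho)].
  move=> r y y' [x Kx xy] [x' Kx' xy']; exists (r *: x + x').
    by apply: subD => //; exact: subZ.
  exact: (subD hrho (subZ r hrho xy) xy').
have KS n : K n.+1 `<=` K n.
  elim: n => [|n IH] y; first by case=> x _ /cod.
  by case=> x /IH Kx xy; exists x.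
have KM n : K n `<=` M by elim: n => // n IH; apply: subset_trans IH; exact: KS.
have NK n : N `<=` K n.+1.
  by move=> y Ny; exists 0; [exact: (sub0 (hK n))|exact: ker].
have [| |_ [n _ <-] Kmin] := aM (range K).
- by exists M; exists 0%N.
- by move=> _ [n _ <-]; split; [exact: hK|exact: KM].
have {Kmin} : K n `<=` K n.+1 by apply: Kmin; [exists n.+1|exact: KS].
elim: n => // n IH Kn; apply: IH => y Ky.
have [z yz] := tot y (KM n _ Ky).
have [x Kx xz] : K n.+2 z by apply: Kn; exists y.
rewrite -[y](subrK x) addrC; apply: (subD (hK n.+1)) => //.
by apply: NK; exact: inj yz xz.
Qed.

(** * Height-preserving partial isomorphisms *)

Section PartialIso.
Variables (R : idomainType) (A : lmodType R).
Implicit Types (S K U V : set A) (F : set (A * A)%type) (x y c d : A).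
Implicit Types (p q r : R).

(** The domain, the inverse and the range of a correspondence, given as a set
    of pairs. *)
Definition dom F : set A := [set x | exists y, F (x, y)].
Definition flip F : set (A * A)%type := [set z | F (z.2, z.1)].
Definition ran F : set A := dom (flip F).

(** [F] is the graph of an isomorphism between two artinian submodules of [A]
    that preserves the heights at every prime. *)
Record partial_iso F : Prop := PartialIso {
  pi_sub : submodule F;
  pi_eq0 : forall x y, F (x, y) -> x = 0 <-> y = 0;
  pi_height : forall p U x y, prime_elt p -> tower p U -> F (x, y) ->
    U x <-> U y;
  pi_dom : artinian (dom F);
  pi_ran : artinian (ran F) }.

Lemma submodule_flip F : submodule F -> submodule (flip F).
Proof.
move=> hF; apply/submoduleP; split; first exact: (sub0 hF).
move=> r [x y] [x' y'] /= Fyx Fyx'.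
exact: (subD hF (subZ r hF Fyx) Fyx').
Qed.

Lemma submodule_dom F : submodule F -> submodule (dom F).
Proof.
move=> hF; apply/submoduleP; split; first by exists 0; exact: (sub0 hF).
move=> r x x' [y xy] [y' xy']; exists (r *: y + y').
exact: (subD hF (subZ r hF xy) xy').
Qed.

Lemma submodule_ran F : submodule F -> submodule (ran F).
Proof. by move=> hF; apply: submodule_dom; exact: submodule_flip. Qed.

Lemma pi_flip F : partial_iso F -> partial_iso (flip F).
Proof.
case=> hF F0 Fh Fd Fr; split=> //; first exact: submodule_flip.
- by move=> x y /F0 [? ?]; split.
- by move=> p U x y hp tU /(Fh p U _ _ hp tU) [? ?]; split.
Qed.

Lemma pi_fun F x y y' : partial_iso F -> F (x, y) -> F (x, y') -> y = y'.
Proof.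
case=> hF F0 _ _ _ Fxy Fxy'; have := subB hF Fxy Fxy'.
rewrite /= => /F0 [+ _].
by rewrite subrr => /(_ erefl) /eqP; rewrite subr_eq0 => /eqP.
Qed.

Lemma dom_adjoin F c d : dom (adjoin F (c, d)) `<=` adjoin (dom F) c.
Proof.
move=> x [y [[x0 y0] [r [Fxy [-> _]]]]]; exists x0, r; split=> //; by exists y0.
Qed.

Lemma flip_adjoin F c d : flip (adjoin F (c, d)) = adjoin (flip F) (d, c).
Proof.
by apply/seteqP; split=> [[x y]|[x y]] [[x0 y0] [r [Fxy [-> ->]]]];
  exists (y0, x0), r.
Qed.

(** [c] lies in [U], and no element of [c + S] is higher than that; if [S]
    contains [0] then the height of [c] is exactly [U]. *)
Definition proper p U S c : Prop :=
  U c /\ forall s, S s -> ~ scale_set p U (c + s).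

Lemma proper_notin p U S c : submodule U -> submodule S ->
  proper p U S c -> ~ S c.
Proof.
move=> hU hS [_ cS] /(subN hS)/cS; rewrite subrr; apply; apply: sub0.
exact: submodule_scale.
Qed.

(** One half of the height preservation in [pi_adjoin]; the other half follows
    by exchanging the two coordinates. *)
Lemma adjoin_height F p U c d q V x y :
  partial_iso F -> prime_elt p -> tower p U -> F (p *: c, p *: d) ->
  proper p U (dom F) c -> U d ->
  prime_elt q -> tower q V -> adjoin F (c, d) (x, y) -> V x -> V y.
Proof.
move=> hPI hp tU Fcd hc Ud hq tV [[x0 y0] [r [F0 [xE yE]]]] Vx.
have [hF _ Fh _ _] := hPI; have hD := submodule_dom hF.
have hU := tower_submodule tU; have hV := tower_submodule tV.
have Dpc : dom F (p *: c) by exists (p *: d).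
have Dx0 : dom F x0 by exists y0.
have [[w rE]|[u [v e]]] : (exists w, r = w * p) \/ comaximal p r.
  by have [_ _] := hp; apply.
  (* Here [(x, y)] already lies in [F]. *)
  suff /(Fh q V x y hq tV)[+ _] : F (x, y) by apply.
  rewrite xE yE rE -!scalerA.
  exact: (subD hF F0 (subZ w hF Fcd)).
have cE : c = u *: (p *: c) + v *: (r *: c).
  by rewrite !scalerA -scalerDl e scale1r.
have nDrc : ~ dom F (r *: c).
  move=> Drc; apply: (proper_notin hU hD hc).
  by rewrite cE; apply: subD => //; exact: subZ.
have [cpq|[w wU qE]] := prime_elt_assoc hp hq.
  (* The [p]-primary element [r *: c] differs from the [q]-primary element [x]
     by [x0], hence it is a multiple of [x0]. *)
  case: nDrc.
  have [k kc] := tower_sub_primary tU hc.1.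
  have [m mx] := tower_sub_primary tV Vx.
  have [a [b ab]] := comaximalXX k m cpq.
  have xE' : x = (a * p ^+ k) *: x0.
    rewrite -[x in LHS]scale1r -ab scalerDl -[(b * _) *: _]scalerA mx.
    rewrite scaler0 addr0.
    rewrite xE scalerDr [X in _ + X]scalerA -[a * _ * r]mulrA [_ ^+ k * r]mulrC.
    by rewrite mulrA -[_ *: c]scalerA kc scaler0 addr0.
  have -> : r *: c = x - x0 by rewrite xE addrC addKr.
  by apply: subB => //; rewrite xE'; exact: subZ.
have {tV} tV : tower p V by apply: tower_assoc wU _; rewrite -qE.
have [VpU|UV] := tower_chain tU tV.
  case: (hc.2 (v *: x0 - u *: (p *: c))).
    by apply: subB => //; exact: subZ.
  apply: VpU; rewrite {1}cE addrC addrA subrK -scalerDr -xE.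
  exact: subZ.
have Vx0 : V x0.
  apply: (subDr hV (y := r *: c)); last by rewrite -xE.
  by apply: subZ => //; apply: UV; case: hc.
rewrite yE; apply: subD => //.
  by have [+ _] := Fh p V x0 y0 hp tV F0; apply.
by apply: subZ => //; exact: UV.
Qed.

Hypothesis R_pid : principal_ideal_domain R.
Hypothesis A_reduced : reduced_module A.

(** Kaplansky's extension step: proper elements of the same height whose
    multiples by [p] correspond may be matched, and heights are preserved at
    every prime. *)
Lemma pi_adjoin F p U c d :
  partial_iso F -> prime_elt p -> tower p U -> F (p *: c, p *: d) ->
  proper p U (dom F) c -> proper p U (ran F) d ->
  partial_iso (adjoin F (c, d)).
Proof.
move=> hPI hp tU Fcd hc hd; have [hF F0 Fh Fd Fr] := hPI.
have hFf := submodule_flip hF.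
have fwd q V x y : prime_elt q -> tower q V -> adjoin F (c, d) (x, y) ->
  V x -> V y by exact: adjoin_height hPI hp tU Fcd hc hd.1.
have bwd q V x y : prime_elt q -> tower q V -> adjoin F (c, d) (x, y) ->
    V y -> V x.
  move=> hq tV Fxy; have : flip (adjoin F (c, d)) (y, x) by [].
  rewrite flip_adjoin.
  exact: adjoin_height (pi_flip hPI) hp tU Fcd hd hc.1 hq tV.
split.
- exact: submodule_adjoin.
- have t0 := tower0 R_pid A_reduced hp.
  move=> x y Fxy; split=> [x0|y0]; first exact: (fwd p _ x y hp t0).
  exact: (bwd p _ x y hp t0).
- move=> q V x y hq tV Fxy.
  by split; [exact: (fwd q V x y)|exact: (bwd q V x y)].
- apply: artinianS (@dom_adjoin F c d) _.
  by apply: artinian_adjoin_prime hp _ => //;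
    [exact: submodule_dom|exists (p *: d)].
- rewrite /ran flip_adjoin; apply: artinianS (@dom_adjoin (flip F) d c) _.
  by apply: artinian_adjoin_prime hp _ => //;
    [exact: submodule_dom|exists (p *: c)].
Qed.

(** The comparison of Ulm invariants: the elements of [U] killed by [p] that
    are proper over the domain exist if and only if they exist over the range.
    For if every element of [U] killed by [p] is congruent modulo [p U] to an
    element of the range, then [x |-> F^-1 t], where [t] is congruent to [x],
    is an injective endomorphism of an artinian quotient of submodules of the
    domain, and it is surjective. *)
Lemma proper_socle F p U c : partial_iso F -> prime_elt p -> tower p U ->
  proper p U (dom F) c -> p *: c = 0 ->
  exists2 d, proper p U (ran F) d & p *: d = 0.
Proof.
move=> hPI hp tU [Uc hc] pc; have [hF F0 Fh Fd _] := hPI.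
have hD := submodule_dom hF; have hU := tower_submodule tU.
have tpU := tower_scale tU; have tppU := tower_scale tpU.
have hpU := tower_submodule tpU; have hppU := tower_submodule tppU.
have pUU := @scale_sub _ _ p U hU.
set pU := scale_set p U in tpU tppU hpU hppU pUU hc *.
set ppU := scale_set p pU in tppU hppU.
apply: contrapT => nex.
have {nex} D d : U d -> p *: d = 0 -> exists t, ran F t /\ pU (d + t).
  move=> Ud pd; apply: contrapT => nt; apply: nex; exists d => //.
  split=> // t Ft pUdt.
  by apply: nt; exists t.
(* [M] consists of the elements of the domain in [U] that are congruent modulo
   [p U] to an element of [U] killed by [p]; [rho] relates [x] to [F^-1 t]. *)
pose M : set A := [set x | [/\ dom F x, U x & ppU (p *: x)]].
have hM : submodule M.
  apply/submoduleP; split; first by rewrite /M /= scaler0; split; exact: sub0.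
  move=> r x y [Dx Ux px] [Dy Uy py]; split.
  - by apply: subD => //; exact: subZ.
  - by apply: subD => //; exact: subZ.
  - by rewrite scalerDr scalerA mulrC -scalerA; apply: subD => //; exact: subZ.
have M_F y t : F (y, t) -> U t -> ppU (p *: t) -> M y.
  move=> Fyt Ut pt; split; first by exists t.
    by have [_] := Fh p U y t hp tU Fyt; apply.
  by have [_] := Fh p ppU _ _ hp tppU (subZ p hF Fyt); apply.
pose rho : set (A * A)%type :=
  [set z | [/\ M z.1, M z.2 & exists2 t, F (z.2, t) & pU (z.1 - t)]].
have surj : forall y, M y -> exists2 x, M x & rho (x, y).
  apply: (@artinian_correspondence_surj _ _ M (dom F `&` pU) rho hM).
  - by apply: artinianS Fd => x [].
  - apply/submoduleP; split.
      split; [exact: (sub0 hM)..|].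
      by exists 0; rewrite ?subr0; [exact: (sub0 hF)|exact: sub0].
    move=> r [x y] [x' y'] [/= Mx My [t Fyt xt]] [/= Mx' My' [t' Fyt' xt']].
    split=> /=; [by apply: subD => //; exact: subZ..|].
    exists (r *: t + t'); first exact: (subD hF (subZ r hF Fyt) Fyt').
    by rewrite opprD addrACA -scalerBr; apply: subD => //; exact: subZ.
  - move=> x Mx; have [Dx Ux [v pUv px]] := Mx.
    have Uv : U v by exact: pUU.
    have pxv : p *: (x - v) = 0 by rewrite scalerBr px subrr.
    have [t [[y Fyt] xvt]] := D (x - v) (subB hU Ux Uv) pxv.
    have pUxt : pU (x - - t).
      by rewrite opprK -[x](subrK v) addrAC; apply: subD.
    have Ft : F (- y, - t) by exact: (subN hF Fyt).
    exists (- y); split=> //=; last by exists (- t).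
    apply: M_F Ft _ _; first apply: subN => //.
      by apply: (subDl hU (x := x - v)); [exact: subB|exact: pUU].
    rewrite scalerN; apply: subN => //.
    by exists (x - v + t); rewrite // scalerDr pxv add0r.
  - by move=> x y [].
  - move=> y [[t Fyt] pUy].
    have pUt : pU t by have [+ _] := Fh p pU y t hp tpU Fyt; apply.
    split=> /=; first exact: sub0.
      by apply: M_F Fyt _ _; [exact: pUU|exists t].
    by exists t => //; rewrite sub0r; exact: subN.
  - move=> x x' y [/= [Dx _ _] _ [t Fyt xt]] [/= [Dx' _ _] _ [t' Fyt' xt']].
    split; first exact: subB.
    move: xt'; rewrite -(pi_fun hPI Fyt Fyt') => xt'.
    have <- : x - t - (x' - t) = x - x' by rewrite opprB addrA subrK.
    exact: subB.
have [t [[y Fyt] pUct]] := D c Uc pc.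
have [|x [Dx _ _] [/= _ _ [t' Fyt' xt]]] := surj y.
- apply: M_F Fyt _ _; first by apply: (subDl hU Uc); exact: pUU.
  by exists (c + t); rewrite // scalerDr pc add0r.
apply: (hc x Dx); rewrite (pi_fun hPI Fyt' Fyt) in xt.
have <- : c + t + (x - t) = c + x by rewrite addrACA subrr addr0.
exact: subD.
Qed.

(** Kaplansky's choice of the image of a proper element. *)
Lemma pi_extend_proper F p U c : partial_iso F -> prime_elt p -> tower p U ->
  dom F (p *: c) -> proper p U (dom F) c ->
  exists G, [/\ partial_iso G, F `<=` G & dom G c].
Proof.
move=> hPI hp tU [w Fcw] [Uc hc]; have [hF _ Fh _ _] := hPI.
have hD := submodule_dom hF; have hU := tower_submodule tU.
have tpU := tower_scale tU; have tppU := tower_scale tpU.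
have hpU := tower_submodule tpU; have hppU := tower_submodule tppU.
have pUU := @scale_sub _ _ p U hU.
have adj c' d : F (p *: c', p *: d) -> dom F (c' - c) ->
    proper p U (dom F) c' -> proper p U (ran F) d ->
    exists G, [/\ partial_iso G, F `<=` G & dom G c].
  move=> Fcd Dc hc' hd; exists (adjoin F (c', d)); split.
  - exact: pi_adjoin hp tU Fcd hc' hd.
  - exact: adjoin_sub.
  - have hG : submodule (dom (adjoin F (c', d))).
      by apply: submodule_dom; exact: submodule_adjoin.
    rewrite -[c](subKr c'); apply: subB => //.
      by exists d; exact: adjoin_self.
    by case: Dc => y Fy; exists y; exact: adjoin_sub.
have [[s [Ds Us [e pUe /esym ppc]]]|nex] := pselect (exists s,
  [/\ dom F s, U s & scale_set p (scale_set p U) (p *: (c + s))]).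
  (* [c + s] differs from an element killed by [p] by the higher element [e]. *)
  have [s' Fss'] := Ds.
  have Fcsw : F (p *: (c + s), w + p *: s').
    by rewrite scalerDr; exact: (subD hF Fcw (subZ p hF Fss')).
  have hcs : proper p U (dom F) (c + s).
    split; first exact: subD.
    by move=> x Dx; rewrite -addrA; apply: hc; exact: subD.
  have [||d' [Ud' hd'] pd'] := @proper_socle F p U (c + s - e) hPI hp tU.
  - split=> [|x Dx pUx]; first by apply: subB; [|exact: hcs.1|exact: pUU].
    apply: (hcs.2 x Dx).
    have -> : c + s + x = c + s - e + x + e by rewrite [RHS]addrAC subrK.
    exact: subD.
  - by rewrite scalerBr ppc subrr.
  have [e' pUe' we'] : scale_set p (scale_set p U) (w + p *: s').
    by have [+ _] := Fh p _ _ _ hp tppU Fcsw; apply; rewrite ppc; exists e.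
  apply: (adj (c + s) (d' + e')) => //.
  - by rewrite [_ *: (d' + _)]scalerDr pd' add0r we'.
  - by rewrite addrC addKr.
  - split=> [|t Dt pUt]; first by apply: subD => //; exact: pUU.
    apply: (hd' t Dt).
    have -> : d' + t = d' + e' + t - e' by rewrite [d' + e' + t]addrAC addrK.
    exact: subB.
(* Otherwise any [d] in [U] with [p *: d = w] is proper: a translate of [d] in
   [p U] would give such an [s]. *)
have [d Ud dE] : scale_set p U w.
  by have [+ _] := Fh p _ _ _ hp tpU Fcw; apply; exists c.
apply: (adj c d) => //; rewrite ?dE ?subrr //; first exact: sub0.
split=> // t [s Fst] pUdt; apply: nex; exists s.
have Ut : U t by apply: (subDl hU Ud); exact: pUU.
split; first by exists t.
  by have [_] := Fh p U s t hp tU Fst; apply.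
have Fp : F (p *: (c + s), p *: (d + t)).
  by rewrite !scalerDr dE; exact: (subD hF Fcw (subZ p hF Fst)).
have [_] := Fh p _ _ _ hp tppU Fp; apply; by exists (d + t).
Qed.

Lemma pi_extend_primary F p c : partial_iso F -> prime_elt p -> primary p c ->
  dom F (p *: c) -> exists G, [/\ partial_iso G, F `<=` G & dom G c].
Proof.
move=> hPI hp pc Dpc; have [hF _ _ Fd _] := hPI; have hD := submodule_dom hF.
have [Dc|nDc] := pselect (dom F c).
  by exists F; split=> // x.
have [s [Ds pcs smax]] := exists_max_height hD Fd pc.
have tU := tower_hull p (c + s).
have [||G [hG FG Gcs]] := pi_extend_proper (c := c + s) hPI hp tU.
- by rewrite scalerDr; apply: subD => //; exact: subZ.
- split=> [|t Dt]; first exact: hull_self.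
  rewrite -addrA => /(smax _ _ (subD hD Ds Dt) (tower_scale tU)).
  move=> /(mem_scale_hull R_pid A_reduced hp pcs) cs0; apply: nDc.
  by rewrite -[c](addrK s) cs0 sub0r; exact: subN.
exists G; split=> //; apply: (subDr (y := s) _ _ Gcs).
  by apply: submodule_dom; case: hG.
by case: Ds => t Fst; exists t; exact: FG.
Qed.

Hypothesis A_torsion : torsion_module A.

(** Induction on an annihilator of [c] reduces to the case that [q c] is in
    the domain, where [c] is the sum of a multiple of [q c] and a [q]-primary
    element. *)
Lemma pi_extend_dom F c : partial_iso F ->
  exists G, [/\ partial_iso G, F `<=` G & dom G c].
Proof.
have [r [r0 rc]] := A_torsion c.
move: r r0 c rc F; apply: (pid_ind R_pid) => [u uU|q r hq IH] c rc F hPI.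
  exists F; split=> //; have -> : c = 0.
    by rewrite -[c]scale1r -(mulVr uU) -scalerA rc scaler0.
  by apply: sub0; apply: submodule_dom; case: hPI.
have [|G [hG FG Gqc]] := IH (q *: c) _ F hPI; first by rewrite scalerA mulrC.
have [n [n0 nc]] := A_torsion c.
have [k [m [nE [u [v e]]]]] := prime_part R_pid hq n0.
have hdG : submodule (dom G) by apply: submodule_dom; case: hG.
have [||H [hH GH Hc]] := @pi_extend_primary G q ((v * m) *: c) hG hq.
- by exists k; rewrite scalerA mulrCA -nE -scalerA nc scaler0.
- by rewrite scalerA mulrC -scalerA; exact: subZ.
exists H; split=> //; first exact: subset_trans GH.
rewrite -[c]scale1r -e scalerDl; apply: subD => //.
  by apply: submodule_dom; case: hH.
rewrite -scalerA; have [y] := subZ u hdG Gqc; by exists y; exact: GH.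
Qed.

Lemma pi_extend F c : partial_iso F ->
  exists G, [/\ partial_iso G, F `<=` G, dom G c & ran G c].
Proof.
move=> /(pi_extend_dom c)[G [hG FG [d Gcd]]].
have [H [hH GH Hc]] := pi_extend_dom c (pi_flip hG).
exists (flip H); split=> //; first exact: pi_flip.
- by move=> [x y] /FG Gxy; exact: (GH (y, x)).
- by exists d; exact: (GH (d, c)).
Qed.

Hypothesis A_cg : countably_generated A.

(** Back and forth: the union of a chain of partial isomorphisms whose domains
    and ranges exhaust a countable set of generators is an automorphism. *)
Lemma pi_extend_aut F : partial_iso F ->
  exists g : {linear A -> A}, bijective g /\ forall x y, F (x, y) -> g x = y.
Proof.
move=> hF0; have [X [cX genX]] := A_cg.
have [e Xe] : exists e : nat -> A, forall x, X x -> exists n, e n = x.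
  move/countable_injP: cX => [f finj].
  have /choice[e eP] : forall n, exists x, (exists2 x, X x & f x = n) ->
      X x /\ f x = n.
    move=> n; have [[x Xx fx]|nx] := pselect (exists2 x, X x & f x = n).
      by exists x.
    by exists 0.
  exists e => x Xx; exists (f x).
  by have [|Xex /finj] := eP (f x); [exists x|apply; exact: mem_set].
have /choice[ext extP] : forall Fc : set (A * A)%type * A, exists G,
    partial_iso Fc.1 ->
    [/\ partial_iso G, Fc.1 `<=` G, dom G Fc.2 & ran G Fc.2].
  move=> [G c] /=; have [hG|] := pselect (partial_iso G); last by exists G.
  by have [H HP] := pi_extend c hG; exists H.
pose fix Fs n := if n is m.+1 then ext (Fs m, e m) else F.
have hFs n : partial_iso (Fs n) by elim: n => //= n /(extP (_, e n))[].
have FsS n : Fs n `<=` Fs n.+1 by have [] := extP (Fs n, e n) (hFs n).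
have Fsle m n : (m <= n)%N -> Fs m `<=` Fs n.
  move/subnK <-; elim: (n - m)%N => // k IH.
  by apply: subset_trans IH _; exact: FsS.
pose G : set (A * A)%type := [set z | exists n, Fs n z].
have hG : submodule G.
  apply/submoduleP; split; first by exists 0%N; apply: sub0; case: hF0.
  move=> r z z' [m Fz] [n Fz']; exists (maxn m n).
  have hmn := pi_sub (hFs (maxn m n)).
  apply: subD => //; last exact: Fsle (leq_maxr m n) _ Fz'.
  by apply: subZ => //; exact: Fsle (leq_maxl m n) _ Fz.
have full (S : set A) : submodule S -> X `<=` S -> forall x, S x.
  move=> hS XS x; have : [set: A] x by [].
  by rewrite -genX; apply.
have domG : forall x, exists y, G (x, y).
  apply: full; first exact: (submodule_dom hG).
  move=> x /Xe[n <-]; have [_ _ [y Fy] _] := extP (Fs n, e n) (hFs n).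
  by exists y, n.+1.
have ranG : forall y, exists x, G (x, y).
  apply: full; first exact: (submodule_ran hG).
  move=> x /Xe[n <-]; have [_ _ _ [y Fy]] := extP (Fs n, e n) (hFs n).
  by exists y, n.+1.
have G0 x y : G (x, y) -> x = 0 <-> y = 0.
  by move=> [n Fn]; exact: pi_eq0 (hFs n) _ _ Fn.
have Gfun x y y' : G (x, y) -> G (x, y') -> y = y'.
  move=> Gxy /(subB hG Gxy)/G0[+ _]; rewrite subrr => /(_ erefl) /eqP.
  by rewrite subr_eq0 => /eqP.
have Ginj x x' y : G (x, y) -> G (x', y) -> x = x'.
  move=> Gxy /(subB hG Gxy)/G0[_]; rewrite subrr => /(_ erefl) /eqP.
  by rewrite subr_eq0 => /eqP.
have [g gP] := choice domG; have [h hP] := choice ranG.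
have glin : linear g.
  move=> r x y; apply: (Gfun (r *: x + y)) => //.
  exact: (subD hG (subZ r hG (gP x)) (gP y)).
pose gL := GRing.isLinear.Build R A A _ g glin.
pose g' : {linear A -> A} := HB.pack g gL.
exists g'; split; last by move=> x y Fxy; apply: (Gfun x) => //; exists 0%N.
exists h => x /=; first by apply: Ginj (hP _) _; exact: gP.
by apply: Gfun (gP _) _; exact: hP.
Qed.

End PartialIso.

(** * From degenerations to partial isomorphisms *)

(** A list is carried to another by an automorphism as soon as the latter list
    is its image under an endomorphism with a left inverse on it, because no
    endomorphism decreases heights. *)
Lemma aut_of_left_inverse (R : idomainType) (A : lmodType R)
    (R_pid : principal_ideal_domain R) (A_reduced : reduced_module A)
    (A_cg : countably_generated A) (A_torsion : torsion_module A)
    (s : seq A) (phi psi : {linear A -> A}) :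
  (forall x, x \in s -> psi (phi x) = x) ->
  exists g : {linear A -> A}, bijective g /\ forall x, x \in s -> g x = phi x.
Proof.
move=> sP; pose F : set (A * A)%type := [set z | span s z.1 /\ z.2 = phi z.1].
have hs := submodule_span s.
have as_ : artinian (span s) by exact: artinian_span.
have spanP : span s `<=` [set x | psi (phi x) = x].
  apply: span_min => //; apply/submoduleP; split; first by rewrite /= !raddf0.
  by move=> r x y /= xE yE; rewrite !linearP xE yE.
have [|g [gbij gP]] := pi_extend_aut R_pid A_reduced A_torsion A_cg (F := F).
- split.
  + apply/submoduleP; split; first by split; [exact: sub0|rewrite /= raddf0].
    move=> r [x y] [x' y'] [/= sx ->] [/= sx' ->]; split=> /=.
      by apply: subD => //; exact: subZ.
    by rewrite linearP.
  + move=> x y [/= /spanP xE ->]; split=> [->|y0]; first by rewrite raddf0.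
    by rewrite -xE y0 raddf0.
  + move=> p U x y hp tU [/= /spanP xE ->].
    split; first exact: (tower_endo phi tU).
    by move/(tower_endo psi tU); rewrite xE.
  + by apply: artinianS as_ => x [y []].
  + have aphi : artinian (phi @` span s) by exact: artinian_image.
    by apply: artinianS aphi => y [x [/= sx ->]]; exists x.
exists g; split=> // x xs; apply: gP; split=> //=; exact: span_mem.
Qed.

(** A power of a permutation of a finite set is its inverse. *)
Lemma finite_set_left_inverse (R : pzRingType) (A : lmodType R) (S : set A)
    (theta : {linear A -> A}) : finite_set S -> theta @` S = S ->
  exists theta' : {linear A -> A}, forall x, S x -> theta' (theta x) = x.
Proof.
move=> /finite_seqP[s sE] thS.
have thP x : x \in s -> theta x \in s.
  move=> xs; have : S (theta x) by rewrite -thS; exists x => //; rewrite sE.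
  by rewrite sE.
pose f (u : seq_sub s) : seq_sub s := SeqSub (thP _ (ssvalP u)).
have finj : injective f.
  apply/injectiveP/card_uniqP; rewrite size_map -cardE.
  apply: eq_card => u; rewrite [RHS]inE.
  have : S (ssval u) by rewrite sE; exact: ssvalP.
  rewrite -thS => -[x]; rewrite sE => xs xu; apply/codomP.
  by exists (SeqSub xs); apply: val_inj.
pose N := #[perm finj]%g.
have itE n (u : seq_sub s) : val (iter n f u) = iter n theta (val u).
  by elim: n => //= n <-.
have [L LE] : exists L : {linear A -> A}, forall x, L x = iter N.-1 theta x.
  elim: N.-1 => [|n [L LE]]; first by exists idfun.
  by exists (theta \o L)%FUN => x /=; rewrite LE.
exists L => x; rewrite sE => xs; rewrite LE -iterSr.
rewrite prednK; last exact: fingroup.order_gt0.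
rewrite -[x]/(val (SeqSub xs)) -itE; congr (val _).
have : (perm finj ^+ N)%g (SeqSub xs) = SeqSub xs by rewrite expg_order perm1.
by rewrite permX => pE; rewrite -[RHS]pE; apply: eq_iter => u; rewrite permE.
Qed.

Theorem theorem5 (R : idomainType) (A : lmodType R)
    (R_pid : principal_ideal_domain R)
    (A_reduced : reduced_module A)
    (A_cg : countably_generated A)
    (A_torsion : torsion_module A) :
  (forall (n : nat) (n_gt0 : (0 < n)%N) (a b : n.-tuple A),
      tuple_degenerates a b -> tuple_degenerates b a ->
      tuple_same_orbit a b) /\
  (forall (S T : set A),
      submodule S -> submodule T -> finite_set S -> finite_set T ->
      submodule_degenerates S T -> submodule_degenerates T S ->
      submodule_same_orbit S T).
Proof.
have key := aut_of_left_inverse R_pid A_reduced A_cg A_torsion.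
split=> [n _ a b [phi phiP] [psi psiP]|S T _ _ finS _ [phi phiST] [psi psiTS]].
  have [|g [gbij gP]] := key a phi psi.
    by move=> _ /tnthP[i ->]; rewrite phiP psiP.
  by exists g; split=> // i; rewrite gP ?phiP // mem_tnth.
have [|theta' thP] := finite_set_left_inverse (theta := (psi \o phi)%FUN) finS.
  by rewrite -image_comp phiST psiTS.
have [s sE] := (finite_seqP S).1 finS.
have [|g [gbij gP]] := key s phi (theta' \o psi)%FUN.
  by move=> x xs; apply: thP; rewrite sE.
exists g; split=> //; rewrite -phiST; apply: eq_imagel => x.
by rewrite sE; exact: gP.
Qed.
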